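(* Let $G$ be a quadrangulation on an orientable surface with a proper vertex-$4$-coloring $g: V(G)\to\{1,2,3,4\}$. Then the number of $(c_1,c_2,c_3,c_4)$-faces in $G$ equals the number of $(c_4,c_3,c_2,c_1)$-faces in $G$, where $\{c_1,c_2,c_3,c_4\}=\{1,2,3,4\}$.
   Context: All graphs are loopless and finite. A cycle is a connected $2$-regular graph. An orientable surface here means a sphere with $k\ge 0$ attached handles. A quadrangulation on such a surface is a $2$-edge-connected graph embedded on the surface such that every face boundary is a cycle of length four. A vertex-coloring is proper if any two adjacent vertices receive different colors. Since the surface is orientable, the clockwise orientation can be fixed, and is fixed, in all faces of $G$ simultaneously. A face of $G$ is a rainbow-face if all four colors appear on its boundary. For $\{c_1,c_2,c_3,c_4\}=\{1,2,3,4\}$, a rainbow-face $F$ is a $(c_1,c_2,c_3,c_4)$-face if the four distinct colors $c_1,c_2,c_3,c_4$ appear on the boundary of $F$ in this clockwise order. This is understood up to cyclic rotation: a $(c_1,c_2,c_3,c_4)$-face is also a $(c_2,c_3,c_4,c_1)$-face, a $(c_3,c_4,c_1,c_2)$-face and a $(c_4,c_1,c_2,c_3)$-face. *)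

(* Defs.v *)
From HB Require Import structures.
From mathcomp Require Import all_boot all_fingroup.

Set Implicit Arguments.
Unset Strict Implicit.
Unset Printing Implicit Defensive.

(** Finite loopless multigraphs.  Every edge is represented by its two
    orientations, the darts [d] and [dart_rev d]; [dart_rev] has no fixed point
    because there are no loops. *)
Record mgraph := MGraph {
  vertex : finType;
  dart : finType;
  source : dart -> vertex;
  dart_rev : dart -> dart;
  dart_revK : involutive dart_rev;
  loopless : forall d, source (dart_rev d) != source d
}.

Section Graph.

Variable G : mgraph.

Definition target (d : dart G) : vertex G := source (dart_rev d).

Definition edge (d : dart G) : {set dart G} := [set d; dart_rev d].

(** In what follows a set [B] of darts that is closed under [dart_rev] stands
    for the set of edges [edges B]. *)
Definition edges (B : {set dart G}) : {set {set dart G}} := edge @: B.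

Definition ends (B : {set dart G}) : {set vertex G} := [set source d | d in B].

Definition adj (B : {set dart G}) : rel (vertex G) :=
  fun u v => [exists d in B, (source d == u) && (target d == v)].

Definition connected (U : {set vertex G}) (B : {set dart G}) : Prop :=
  U != set0 /\ {in U &, forall u v, connect (adj B) u v}.

Definition degree (B : {set dart G}) (v : vertex G) : nat :=
  #|[set d in B | source d == v]|.

(** The subgraph formed by the edges of [B] and their ends is a cycle. *)
Definition is_cycle (B : {set dart G}) : Prop :=
  connected (ends B) B /\ {in ends B, forall v, degree B v = 2}.

Definition two_edge_connected : Prop :=
  [/\ 1 < #|vertex G|,
      connected setT setT &
      forall d : dart G, connected setT (~: edge d)].

Definition proper_coloring (C : finType) (g : vertex G -> C) : Prop :=
  forall u v, adj setT u v -> g u != g v.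

Definition dart_rev_perm : {perm dart G} := perm (inv_inj (@dart_revK G)).

End Graph.

(** Cellular embeddings in oriented closed surfaces, given by rotation systems:
    [rot] sends a dart to the next one, in anticlockwise order, among the darts
    with the same source. *)
Record embedding (G : mgraph) := Embedding {
  rot : {perm dart G};
  rotP : forall d d' : dart G, (d' \in porbit rot d) = (source d' == source d)
}.

Section Embedding.

Variables (G : mgraph) (M : embedding G).

(** [face_perm d = rot (dart_rev d)]: at the target of [d], turn into the first
    dart met anticlockwise after [dart_rev d], i.e. turn right as sharply as
    possible.  The face on the right of [d] is thereby traversed clockwise. *)
Definition face_perm : {perm dart G} := (dart_rev_perm G * rot M)%g.

(** A face is identified with the set of darts of its clockwise facial walk. *)
Definition faces : {set {set dart G}} := porbits face_perm.

Definition boundary (F : {set dart G}) : {set dart G} :=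
  F :|: [set dart_rev d | d in F].

(** The surface defined by the rotation system of a connected graph is the
    sphere with [k] handles, where [#V - #E + #F = 2 - 2k]. *)
Definition on_surface (k : nat) : Prop :=
  #|vertex G| + #|faces| + k.*2 = #|edges [set: dart G]| + 2.

Definition quadrangulation (k : nat) : Prop :=
  [/\ two_edge_connected G,
      on_surface k &
      {in faces, forall F,
         is_cycle (boundary F) /\ #|edges (boundary F)| = 4}].

Definition rainbow (g : vertex G -> 'I_4) (F : {set dart G}) : bool :=
  [set g v | v in ends (boundary F)] == setT.

(** The existential over the starting dart [d] makes this invariant under
    cyclic rotation of the colors. *)
Definition colored_face (g : vertex G -> 'I_4) (c1 c2 c3 c4 : 'I_4)
    (F : {set dart G}) : bool :=
  rainbow g F &&
  [exists d in F,
    [&& g (source d) == c1,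
        g (source (face_perm d)) == c2,
        g (source (face_perm (face_perm d))) == c3 &
        g (source (face_perm (face_perm (face_perm d)))) == c4]].

Definition num_faces (g : vertex G -> 'I_4) (c1 c2 c3 c4 : 'I_4) : nat :=
  #|[set F in faces | colored_face g c1 c2 c3 c4 F]|.

End Embedding.

(* Main.v *)
Require Import Defs.
From HB Require Import structures.
From mathcomp Require Import all_boot all_fingroup.

(** Call a dart ascending if its end colors are [c_i], [c_(i+1)] with indices
    mod 4, and descending if its reverse is ascending.  Reversal exchanges the
    two kinds, so they are equinumerous.  The darts are partitioned by the faces,
    and the four darts of a face contribute (ascending minus descending) 4 for a
    (c1,c2,c3,c4)-face, -4 for a (c4,c3,c2,c1)-face and 0 for any other face.
    That a face has four darts holds because its facial walk is
    non-backtracking on a cycle, hence never uses an edge in both directions. *)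

Set Implicit Arguments.
Unset Strict Implicit.
Unset Printing Implicit Defensive.

(** The arguments stand for positions, from 0 to 3, in the list of the four colors. *)
Definition ascending (i j : nat) : bool := j == i.+1 %% 4.

(** The steps of the closed walk [w] are 1, -1 or 2 mod 4 and add up to 0 mod 4, so 1 and -1 occur
    equally often unless all steps are 1 or all are -1. Placing the corrections on opposite sides
    avoids subtraction in [nat]. *)
Lemma quad_ascending (i0 i1 i2 i3 : nat) :
    i0 < 4 -> i1 < 4 -> i2 < 4 -> i3 < 4 ->
    i0 != i1 -> i1 != i2 -> i2 != i3 -> i3 != i0 ->
  let w := [:: (i0, i1); (i1, i2); (i2, i3); (i3, i0)] in
  let q := [:: (i0, i1, i2, i3); (i1, i2, i3, i0);
               (i2, i3, i0, i1); (i3, i0, i1, i2)] in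
  \sum_(p <- w) ascending p.1 p.2 + 4 * ((3, 2, 1, 0) \in q) =
  \sum_(p <- w) ascending p.2 p.1 + 4 * ((0, 1, 2, 3) \in q).
Proof.
rewrite /= !big_cons !big_nil.
by move: i0 i1 i2 i3 => [|[|[|[|?]]]] [|[|[|[|?]]]] [|[|[|[|?]]]] [|[|[|[|?]]]].
Qed.

Section FaceOrbits.

Variables (G : mgraph) (M : embedding G).
Local Notation f := (face_perm M).

Lemma face_permE (d : dart G) : f d = Defs.rot M (dart_rev d).
Proof. by rewrite permM permE. Qed.

Lemma source_face_perm (d : dart G) : source (f d) = target d.
Proof. by apply/eqP; rewrite face_permE -(Defs.rotP M) (mem_porbit _ 1). Qed.

Lemma dart_rev_neq (d : dart G) : dart_rev d != d.
Proof. by apply/eqP => e; have := loopless d; rewrite e eqxx. Qed.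

Lemma sum_dart_rev (r : rel (vertex G)) :
  \sum_(d : dart G) r (source d) (target d) =
  \sum_(d : dart G) r (target d) (source d).
Proof.
rewrite (reindex_inj (inv_inj (@dart_revK G))) /=.
by apply: eq_bigr => d _; rewrite /target dart_revK.
Qed.

Section Face.

Variable F : {set dart G}.
Hypotheses (FM : F \in faces M) (cycF : is_cycle (boundary F)).

Lemma mem_face (d : dart G) : d \in F -> F = porbit f d.
Proof.
by case/imsetP: FM => d0 _ ->; rewrite -eq_porbit_mem => /eqP.
Qed.

Lemma face_perm_mem (d : dart G) : (f d \in F) = (d \in F).
Proof.
case/imsetP: FM => d0 _ ->.
by rewrite -!eq_porbit_mem (porbit_perm f 1 d).
Qed.

Lemma mem_boundary (d : dart G) : d \in F -> d \in boundary F.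
Proof. by rewrite inE => ->. Qed.

Lemma rev_boundary (d : dart G) : d \in F -> dart_rev d \in boundary F.
Proof. by move=> dF; rewrite inE imset_f ?orbT. Qed.

(** Otherwise the rotation fixes [dart_rev d], which is then the only dart leaving the target of
    [d], against degree 2 on the cycle. *)
Lemma face_perm_neq (d : dart G) : d \in F -> f d != dart_rev d.
Proof.
move=> dF; apply/eqP => fd.
have [_ /(_ (target d))] := cycF.
have rB := rev_boundary dF.
move=> /(_ (imset_f _ rB)) deg2.
have: degree (boundary F) (target d) <= #|[set dart_rev d]|.
  apply: subset_leq_card; apply/subsetP => e; rewrite !inE.
  rewrite -(Defs.rotP M) => /andP[_ /porbitP[n ->]].
  rewrite permX; apply/eqP; elim: n => //= n ->.
  by rewrite -face_permE.
by rewrite deg2 cards1.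
Qed.

(** The distinct darts [dart_rev d] and [f d] already exhaust the degree 2 of the target of [d]. *)
Lemma boundary_dart (d e : dart G) : d \in F -> e \in boundary F ->
  source e = target d -> e = dart_rev d \/ e = f d.
Proof.
move=> dF eB se; have [_ /(_ (target d))] := cycF.
have rB := rev_boundary dF.
move=> /(_ (imset_f _ rB)) deg2.
have fB : f d \in boundary F.
  by apply: mem_boundary; rewrite face_perm_mem.
have /eqP eqS : [set dart_rev d; f d] ==
    [set x in boundary F | source x == target d].
  rewrite eqEcard; apply/andP; split.
    apply/subsetP => x /set2P[] ->; rewrite inE ?rB ?fB //=.
    by rewrite source_face_perm.
  by rewrite [X in X <= _]deg2 cards2 eq_sym face_perm_neq.
by apply/set2P; rewrite eqS inE eB se /=.
Qed.

(** A walk using an edge both ways also retraces the next edge: the predecessor [e] of [dart_rev d]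
    ends where [f d] starts, so [boundary_dart] leaves only [f d = dart_rev e]. *)
Lemma face_perm_rev (d : dart G) :
  d \in F -> dart_rev d \in F -> f (dart_rev (f d)) = dart_rev d.
Proof.
move=> dF rF; set e := (f^-1)%g (dart_rev d).
have fe : f e = dart_rev d by rewrite permKV.
have eF : e \in F by rewrite -face_perm_mem fe.
have te : target e = target d by rewrite -source_face_perm fe.
have fB : f d \in boundary F.
  by apply: mem_boundary; rewrite face_perm_mem.
have [|||->|/perm_inj fd] := @boundary_dart e (f d) => //.
  by rewrite source_face_perm te.
  by rewrite dart_revK.
by have := face_perm_neq dF; rewrite -fe -fd eqxx.
Qed.

Lemma face_rev (d : dart G) : d \in F -> dart_rev d \notin F.
Proof.
(* If [dart_rev d = f^n d], then [dart_rev (f^j d) = f^(n-j) d]; the middle of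
   the walk from [d] to [dart_rev d] is a loop or a backtracking step. *)
have step n : forall e, e \in F -> dart_rev e != iter n f e.
  elim/ltn_ind: n => -[|[|n]] IHn e eF; first exact: dart_rev_neq.
    by rewrite eq_sym face_perm_neq.
  apply/eqP => re.
  have rF : dart_rev e \in F.
    by rewrite re; elim: n.+2 => //= m; rewrite face_perm_mem.
  (* One dart is dropped at either end of the walk, hence [n] in place of [n.+2]. *)
  have := IHn n (ltnW (ltnSn _)) (f e); rewrite face_perm_mem => /(_ eF) /eqP.
  by case; apply: (@perm_inj _ f); rewrite face_perm_rev // re -iterSr.
move=> dF; apply/negP; rewrite {1}(mem_face dF) => /porbitP[n].
by rewrite permX => /eqP; apply/negP/step.
Qed.

(** By [face_rev], [edge] is injective on [F]. *)
Lemma card_face : #|F| = #|edges (boundary F)|.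
Proof.
have -> : edges (boundary F) = @edge G @: F.
  apply/setP => E; apply/imsetP/imsetP => -[d].
    rewrite inE => /orP[dF|/imsetP[e eF ->]] ->; first by exists d.
    by exists e; rewrite // /edge dart_revK setUC.
  by move=> dF ->; exists d; rewrite // inE dF.
rewrite card_in_imset // => d e dF eF /setP /(_ d).
rewrite !inE eqxx /= => /esym /orP[/eqP //|/eqP de].
by have := face_rev eF; rewrite -de dF.
Qed.

End Face.

Lemma sum_faces (E : dart G -> nat) :
  \sum_d E d = \sum_(F in faces M) \sum_(d in F) E d.
Proof.
rewrite (partition_big (porbit f) (mem (faces M))) /=; last first.
  by move=> d _; rewrite imset_f.
apply: eq_bigr => F FM; apply: eq_bigl => d; apply/eqP/idP => [<-|dF].
  exact: porbit_id.
by rewrite -(mem_face FM dF).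
Qed.

End FaceOrbits.

Section ColoredFaces.

Variables (G : mgraph) (M : embedding G) (g : vertex G -> 'I_4).
Local Notation f := (face_perm M).

Definition walk_colors (d : dart G) : 'I_4 * 'I_4 * 'I_4 * 'I_4 :=
  (g (source d), g (source (f d)), g (source (f (f d))),
   g (source (f (f (f d))))).

Lemma colored_faceE (c1 c2 c3 c4 : 'I_4) (F : {set dart G}) :
    [set c1; c2; c3; c4] = [set: 'I_4] -> F \in faces M ->
  colored_face M g c1 c2 c3 c4 F =
    ((c1, c2, c3, c4) \in [set walk_colors d | d in F]).
Proof.
move=> cT FM; have mF := face_perm_mem FM.
have gF e : e \in F -> g (source e) \in [set g v | v in ends (boundary F)].
  by move=> eF; rewrite !imset_f ?mem_boundary.
apply/andP/imsetP => [[_ /existsP[d]]|[d dF [e1 e2 e3 e4]]].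
  case/and5P => dF /eqP e1 /eqP e2 /eqP e3 /eqP e4.
  by exists d; rewrite // /walk_colors e1 e2 e3 e4.
split; last by apply/existsP; exists d; rewrite dF -e1 -e2 -e3 -e4 !eqxx.
(* By [cT] every color is one of the four read along the walk from [d]. *)
rewrite /rainbow -subTset -cT; apply/subsetP => c; rewrite !inE -!orbA.
by case/or4P => /eqP->; rewrite ?e1 ?e2 ?e3 ?e4 gF ?mF.
Qed.

Variables c1 c2 c3 c4 : 'I_4.
Hypotheses (gP : proper_coloring g) (cT : [set c1; c2; c3; c4] = [set: 'I_4]).

(** Renumbering the colors turns the two cyclic orders into 0, 1, 2, 3 and its reverse. *)
Let pos (c : 'I_4) : nat := index c [:: c1; c2; c3; c4].

Lemma mem_colors (c : 'I_4) : c \in [:: c1; c2; c3; c4].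
Proof.
by have := in_setT c; rewrite -cT !inE -!orbA.
Qed.

Lemma pos_inj : injective pos.
Proof. by move=> a b; exact: (index_inj c1 (mem_colors a) (mem_colors b)). Qed.

(** A list of length 4 that contains all 4 colors has no repetition. *)
Lemma uniq_colors : uniq [:: c1; c2; c3; c4].
Proof.
apply/card_uniqP; rewrite -[RHS](card_ord 4).
by apply: eq_card => c; rewrite mem_colors.
Qed.

Lemma pos_colors : (pos c1, pos c2, pos c3, pos c4) = (0, 1, 2, 3).
Proof.
have posE n : n < 4 -> pos (nth c1 [:: c1; c2; c3; c4] n) = n.
  by move=> n4; apply: index_uniq => //; apply: uniq_colors.
by rewrite (posE 0) // (posE 1) // (posE 2) // (posE 3).
Qed.

Lemma face_balance (F : {set dart G}) : F \in faces M -> #|F| = 4 ->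
  \sum_(d in F) ascending (pos (g (source d))) (pos (g (target d))) +
    4 * colored_face M g c4 c3 c2 c1 F =
  \sum_(d in F) ascending (pos (g (target d))) (pos (g (source d))) +
    4 * colored_face M g c1 c2 c3 c4 F.
Proof.
move=> FM F4; case/imsetP: (FM) => d _ defF.
have cT' : [set c4; c3; c2; c1] = [set: 'I_4].
  by apply/setP => c; have := mem_colors c; rewrite !inE; do !case: eqP.
rewrite !colored_faceE //.
have sF : F =i traject f d 4 by rewrite -F4 defF; apply: porbit_traject.
have uF : uniq (traject f d 4) by rewrite -F4 defF uniq_traject_porbit.
have f4 : f (f (f (f d))) = d by rewrite -[RHS](iter_porbit f) -defF F4.
have adjP e : pos (g (source e)) != pos (g (source (f e))).
  rewrite (inj_eq pos_inj); apply: gP; apply/existsP; exists e.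
  by rewrite inE source_face_perm !eqxx.
(* Injectivity of [J] transfers membership of color quadruples to position quadruples, the form used
   in [quad_ascending]. *)
pose J (q : 'I_4 * 'I_4 * 'I_4 * 'I_4) :=
  (pos q.1.1.1, pos q.1.1.2, pos q.1.2, pos q.2).
have J_inj : injective J.
  move=> [[[a1 a2] a3] a4] [[[b1 b2] b3] b4].
  by case => /pos_inj-> /pos_inj-> /pos_inj-> /pos_inj->.
have walkE q : (q \in [set walk_colors e | e in F]) =
    (J q \in [seq J (walk_colors e) | e <- traject f d 4]).
  rewrite (map_comp J walk_colors) (mem_map J_inj).
  by apply/imsetP/mapP => -[e]; rewrite ?sF => eF ->; exists e; rewrite ?sF.
have sumE (r : nat -> nat -> bool) :
    \sum_(e in F) r (pos (g (source e))) (pos (g (target e))) =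
    \sum_(p <- [seq (pos (g (source e)), pos (g (source (f e))))
                | e <- traject f d 4]) r p.1 p.2.
  rewrite big_map [RHS]big_uniq //=; apply: eq_big => [e|e _]; first by rewrite sF.
  by rewrite source_face_perm.
rewrite (sumE ascending) (sumE (fun i j => ascending j i)) !walkE.
case: pos_colors => p1 p2 p3 p4.
rewrite /J /= !f4 p1 p2 p3 p4.
have lt4 c : pos c < 4 by have := mem_colors c; rewrite -index_mem.
apply: quad_ascending => //.
(* The step from the fourth dart back to [d] closes the walk. *)
by rewrite -[X in _ != pos (g (source X))]f4.
Qed.

End ColoredFaces.

Theorem theorem1 (k : nat) (G : mgraph) (M : embedding G)
    (g : vertex G -> 'I_4) (c1 c2 c3 c4 : 'I_4) :
  quadrangulation M k ->
  proper_coloring g ->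
  [set c1; c2; c3; c4] = [set: 'I_4] ->
  num_faces M g c1 c2 c3 c4 = num_faces M g c4 c3 c2 c1.
Proof.
move=> [_ _ quadF] gP cT.
have numE a b c e : num_faces M g a b c e =
    \sum_(F in faces M) colored_face M g a b c e F.
  by rewrite /num_faces -sum1dep_card big_mkcondr.
pose r u v : bool :=
  ascending (index (g u) [:: c1; c2; c3; c4]) (index (g v) [:: c1; c2; c3; c4]).
apply/eqP; rewrite -(eqn_pmul2l (isT : 0 < 4)) !numE !big_distrr /=.
(* The number of ascending darts is added to both sides and, on one of them, rewritten as the number
   of descending darts; the equation then splits into [face_balance] for each face. *)
rewrite -(eqn_add2l (\sum_(d : dart G) r (source d) (target d))).
rewrite {1}(sum_dart_rev r) !(sum_faces M) -!big_split /= eq_sym; apply/eqP.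
apply: eq_bigr => F FM; have [cycF F4] := quadF F FM.
by apply: face_balance; rewrite // (card_face FM cycF).
Qed.
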